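(* Let $d=1$, let $r,n\ge 1$ be integers, and let $F=(F_1,\dots,F_r)$ be an affine iterated function system on $\mathbb{R}$ such that (with $K_0=[-1,1]$) there is $\epsilon>0$ for which the distance between $F_i(K_0)$ and $F_{i'}(K_0)$ exceeds $\epsilon$ for all $i\ne i'$, and such that $F_i(K_0)\subseteq K_0$ for every $i$. Let $\mathcal{D}_n=\frac12(\mathcal{D}_n^++\mathcal{D}_n^-)$ be a fractal distribution on $\mathbb{R}\times\{\pm1\}$ for $F$ of depth $n$, with approximation curve $P$, for which there is $\gamma>0$ such that $\mathcal{D}_n^+$ is supported on $K_n^\gamma\times\{+1\}$. For every $j$, $K_j$ is a union of $r^j$ intervals, $K_j=\bigcup_{i=1}^{r^j}I_i$; assume that the distribution over each interval is equal, i.e. for every $j$, all $i,\ell\in\{1,\dots,r^j\}$ and every $y'\in\{\pm1\}$, $$\mathbb{P}_{(x,y)\sim\mathcal{D}_n}[x\in I_i\text{ and }y=y']=\mathbb{P}_{(x,y)\sim\mathcal{D}_n}[x\in I_\ell\text{ and }y=y'].$$ Then for every depth $t\ge 1$, every positive integer $s$, every width $k<r^s$, and every integer $j$ with $n>j>st$, $$L_{\mathcal{D}_n}(\mathcal{H}_{k,t})\ \ge\ (1-r^{st-j})\,(1-P(j)).$$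
   Context: Affine IFS on $\mathbb{R}$: maps $F_i(x)=m_ix+v_i$, $i=1,\dots,r$, with $m_i\ne0$ and $|F_i(x)-F_i(y)|<|x-y|$ for all $x\neq y$. Sets: $K_0=[-1,1]$ and $K_j=F_1(K_{j-1})\cup\dots\cup F_r(K_{j-1})$; the $r^j$ intervals of $K_j$ are the sets $F_{i_1}\circ\dots\circ F_{i_j}(K_0)$. A fractal distribution of depth $n$ is a probability distribution $\mathcal{D}_n=\frac12(\mathcal{D}_n^++\mathcal{D}_n^-)$ on $\mathbb{R}\times\{\pm1\}$, where $\mathcal{D}_n^+$ is a probability distribution supported on $K_n\times\{+1\}$ and $\mathcal{D}_n^-$ one supported on $(\mathbb{R}\setminus K_n)\times\{-1\}$. For a set $A$ and $\gamma>0$, $A^\gamma=\{x\in A: B_\gamma(x)\subseteq A\}$, where $B_\gamma(x)$ is the ball of radius $\gamma$ around $x$. The approximation curve is $P(j)=\mathbb{P}_{(x,y)\sim\mathcal{D}_n}[x\notin K_j\text{ or }y=1]$. $\mathcal{H}_{k,t}$ is the set of functions $h:\mathbb{R}\to\mathbb{R}$ computed by ReLU networks of depth $t$ and width $k$: $x^{(0)}=x$, $x^{(t')}=\sigma(W^{(t')}x^{(t'-1)}+b^{(t')})$ for $1\le t'\le t-1$, output $x^{(t)}=W^{(t)}x^{(t-1)}+b^{(t)}\in\mathbb{R}$, all hidden layers of dimension $k$, $\sigma(z)=\max(z,0)$ coordinatewise. Errors: $L_{\mathcal{D}}(h)=\mathbb{P}_{(x,y)\sim\mathcal{D}}[\operatorname{sign}(h(x))\ne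 y]$ and $L_{\mathcal{D}}(\mathcal{H}_{k,t})=\min_{h\in\mathcal{H}_{k,t}}L_{\mathcal{D}}(h)$. *)

(* Defs.v *)
From HB Require Import structures.
From mathcomp Require Import all_boot all_order all_algebra.
From mathcomp Require Import all_classical all_reals all_analysis.

Set Implicit Arguments.
Unset Strict Implicit.
Unset Printing Implicit Defensive.

Import Order.TTheory GRing.Theory Num.Theory.
Import numFieldNormedType.Exports.

Local Open Scope classical_set_scope.
Local Open Scope ring_scope.

Record affine_ifs (R : realType) (r : nat) := AffineIFS {
  slope : 'I_r -> R;
  shift : 'I_r -> R;
  slope_neq0 : forall i, slope i != 0;
  contractive : forall i (x y : R), x != y ->
    `|(slope i * x + shift i) - (slope i * y + shift i)| < `|x - y| }.

Definition ifs_map (R : realType) (r : nat) (F : affine_ifs R r) (i : 'I_r)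
  (x : R) : R := slope F i * x + shift F i.

Definition K0 (R : realType) : set R := `[-1, 1].

Fixpoint Kset (R : realType) (r : nat) (F : affine_ifs R r) (j : nat) : set R :=
  if j is j'.+1 then \bigcup_(i in [set: 'I_r]) (ifs_map F i @` Kset F j')
  else @K0 R.

(* For w = (i_1, ..., i_j), this is F_{i_1} o ... o F_{i_j} (K_0).  The r ^ j
   words of length j index the intervals of K_j. *)
Definition Kinterval (R : realType) (r : nat) (F : affine_ifs R r) (j : nat)
  (w : j.-tuple 'I_r) : set R :=
  (fun x : R => foldr (ifs_map F) x w) @` @K0 R.

Definition set_dist (R : realType) (A B : set R) : R :=
  inf [set `|x - y| | x in A & y in B].

Definition shrink (R : realType) (A : set R) (gamma : R) : set R :=
  [set x | A x /\ ball x gamma `<=` A].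

(* The label set {+1, -1} is represented by bool, with true standing for +1. *)
Definition label (R : realType) (b : bool) : R := if b then 1 else -1.

Definition supported_on (R : realType) (mu : probability (R * bool)%type R)
  (A : set (R * bool)) : Prop := mu A = 1%E.

Definition fractal_distribution (R : realType) (r : nat) (F : affine_ifs R r)
  (n : nat) (D Dp Dm : probability (R * bool)%type R) : Prop :=
  [/\ forall A, measurable A -> D A = ((2^-1 : R)%:E * (Dp A + Dm A))%E,
      supported_on Dp (Kset F n `*` [set true])
    & supported_on Dm (~` Kset F n `*` [set false])].

Definition approx_curve (R : realType) (r : nat) (F : affine_ifs R r)
  (D : probability (R * bool)%type R) (j : nat) : \bar R :=
  D [set xy | ~ Kset F j xy.1 \/ xy.2 = true].

Definition relu (R : realType) (p : nat) (z : 'cV[R]_p) : 'cV[R]_p :=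
  map_mx (fun a => Num.max a 0) z.

Definition layer_dim (k i : nat) : nat := if i is 0 then 1%N else k.

(* hidden_layer W b i x is x^(i); W i and b i are W^(i+1) and b^(i+1). *)
Fixpoint hidden_layer (R : realType) (k : nat)
  (W : forall i, 'M[R]_(k, layer_dim k i)) (b : nat -> 'cV[R]_k)
  (i : nat) (x : R) : 'cV[R]_(layer_dim k i) :=
  match i return 'cV[R]_(layer_dim k i) with
  | 0 => \col_(_ < 1) x
  | i'.+1 => relu (W i' *m hidden_layer W b i' x + b i')
  end.

(* Meaningful for t >= 1; only the first t - 1 entries of W and b matter. *)
Definition relu_networks (R : realType) (k t : nat) : set (R -> R) :=
  [set h | exists (W : forall i, 'M[R]_(k, layer_dim k i)) (b : nat -> 'cV[R]_k)
                  (Wout : 'M[R]_(1, layer_dim k t.-1)) (bout : 'cV[R]_1),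
     forall x, h x = (Wout *m hidden_layer W b t.-1 x + bout) 0 0].

(* Num.sg 0 = 0, so a point where h vanishes is misclassified. *)
Definition error (R : realType) (D : probability (R * bool)%type R)
  (h : R -> R) : \bar R :=
  D [set xy | Num.sg (h xy.1) != label R xy.2].

(* An infimum, since the minimum over the class need not be attained. *)
Definition class_error (R : realType) (D : probability (R * bool)%type R)
  (H : set (R -> R)) : \bar R :=
  ereal_inf [set error D h | h in H].

(* Main.v *)
(** A hidden layer of width k splits each piece on which its input is affine
    into at most k + 1 pieces, so a network of depth t and width k is affine on
    each of at most (k + 1)^(t-1) consecutive pieces.  Splitting once more, its
    positivity is constant on each of at most 2 (k + 1)^(t-1) pieces, which is
    at most r^(st) unless r = 1, where the bound is trivial.  Disjoint intervals
    of K_j that meet several pieces first cross between pieces at different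
    places, so at most r^(st) of the r^j intervals are not classified uniformly.
    On every other interval the network errs on the whole positive or the whole
    negative mass; all intervals carry equal mass of each label, and the
    negative one is the smaller, equal to (1 - P(j)) / r^j. *)

Require Import Defs.
From HB Require Import structures.
From mathcomp Require Import all_boot all_order all_algebra.
From mathcomp Require Import all_classical all_reals all_analysis.
From mathcomp Require Import measurable_realfun.

Set Implicit Arguments.
Unset Strict Implicit.
Unset Printing Implicit Defensive.

Import Order.TTheory GRing.Theory Num.Theory.
Import numFieldNormedType.Exports.

Local Open Scope classical_set_scope.
Local Open Scope ring_scope.

(** * Piecewise affine structure of ReLU networks *)

(* The pieces are the fibres of phi, hence convex since phi is monotone, and
   at most N of them are nonempty. *)
Definition affine_pieces (R : realType) (p N : nat) (f : R -> 'cV[R]_p)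
    (phi : R -> nat) : Prop :=
  [/\ {homo phi : x y / x <= y >-> (x <= y)%N}, forall x, (phi x < N)%N
    & forall v, exists A C : 'cV[R]_p, forall x, phi x = v -> f x = x *: A + C].

Lemma affine_pieces_affine (R : realType) (p q N : nat) (f : R -> 'cV[R]_p)
    (phi : R -> nat) (W : 'M[R]_(q, p)) (b : 'cV[R]_q) :
  affine_pieces N f phi -> affine_pieces N (fun x => W *m f x + b) phi.
Proof.
case=> phi_homo phi_lt aff; split=> // v; have [A [C fE]] := aff v.
exists (W *m A), (W *m C + b) => x /fE ->.
by rewrite mulmxDr -scalemxAr addrA.
Qed.

(** On a piece each coordinate is affine, so its positivity switches at most once. The [p] switching
    points cut the piece into at most [p.+1] parts, rather than one for each of the [2 ^ p] sign
    patterns. *)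
Lemma sign_refinement (R : realType) (p N : nat) (f : R -> 'cV[R]_p)
    (phi : R -> nat) :
  affine_pieces N f phi ->
  exists psi : R -> nat,
    [/\ {homo psi : x y / x <= y >-> (x <= y)%N},
        forall x, (psi x < N * p.+1)%N
      & forall x y, psi x = psi y ->
          phi x = phi y /\ forall l, (0 < f x l 0) = (0 < f y l 0)].
Proof.
case=> phi_homo phi_lt /choice[A] /choice[C] fE.
(* On each piece of phi, b l is a nondecreasing 0/1-valued function of x. *)
pose b (l : 'I_p) x : bool := (0 < f x l 0) == (0 <= A (phi x) l 0).
pose S x := (\sum_(l < p) b l x)%N.
have S_le x : (S x <= p)%N.
  apply: (@leq_trans (\sum_(l < p) 1)%N); last by rewrite sum1_card card_ord.
  by apply: leq_sum => l _; exact: leq_b1.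
have b_homo l x y : x <= y -> phi x = phi y -> (b l x <= b l y)%N.
  move=> xy pxy; rewrite /b pxy (fE _ _ pxy) (fE _ _ erefl) !mxE.
  set a := A _ _ _; set c := C _ _ _.
  have [a0|a0] := leP 0 a.
    have [h|] := ltP 0 (x * a + c); last by case: (0 < _).
    by rewrite (lt_le_trans h) ?lerD2r ?ler_wpM2r.
  have [//|h] := ltP 0 (x * a + c).
  by rewrite ltNge (le_trans _ h) // lerD2r ler_wnM2r // ltW.
(* Since [S x <= p], this encodes the pair [(phi x, S x)] in base [p.+1], and the order of the codes
   is lexicographic. *)
exists (fun x => phi x * p.+1 + S x)%N; split.
- move=> x y xy; have := phi_homo _ _ xy.
  rewrite leq_eqVlt => /orP[/eqP pxy|pxy].
    by rewrite pxy leq_add2l; apply: leq_sum => l _; exact: b_homo.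
  apply: (@leq_trans ((phi x).+1 * p.+1)); last first.
    by rewrite (leq_trans (leq_mul pxy (leqnn _))) ?leq_addr.
  by rewrite mulSn addnC leq_add2r (leq_trans (S_le x)).
- move=> x; apply: (@leq_trans ((phi x).+1 * p.+1)).
    by rewrite mulSn addnC ltn_add2r ltnS.
  exact: leq_mul.
- move=> x y eq_xy.
  have pxy : phi x = phi y.
    have divE z : ((phi z * p.+1 + S z) %/ p.+1 = phi z)%N.
      by rewrite divnMDl // divn_small ?addn0 // ltnS.
    by rewrite -(divE x) eq_xy divE.
  have Sxy : S x = S y by move/eqP: eq_xy; rewrite pxy eqn_add2l => /eqP.
  split=> // l.
  wlog xy : x y pxy Sxy {eq_xy} / x <= y.
    by move=> th; case: (leP x y) => [|/ltW] xy; [|symmetry]; exact: th.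
  (* The terms of [S x] are bounded by those of [S y]; equality of the sums forces equality term by
     term. *)
  have : b l x = b l y.
    have bS : forall l : 'I_p, true -> (b l x <= b l y ?= iff (b l x == b l y :> nat))%N.
      by move=> i _; apply/leqifP; case: eqP => // /eqP ne; rewrite ltn_neqAle ne b_homo.
    have [_] := leqif_sum bS; rewrite -/(S x) -/(S y) Sxy eqxx => /esym/forallP/(_ l).
    by case: (b l x); case: (b l y).
  rewrite /b pxy; by case: (0 < f x l 0); case: (0 < f y l 0); case: (0 <= _).
Qed.

(** Once every coordinate has constant positivity on a piece, [relu] either keeps its affine formula
    or replaces it by zero; a point [x0] of the piece decides which. *)
Lemma affine_pieces_relu (R : realType) (p N : nat) (f : R -> 'cV[R]_p)
    (phi : R -> nat) :
  affine_pieces N f phi ->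
  exists psi, affine_pieces (N * p.+1) (fun x => relu (f x)) psi.
Proof.
move=> aff; have [psi [psi_homo psi_lt psiP]] := sign_refinement aff.
exists psi; split=> // v.
have [[x0 <-]|empty] := pselect (exists x, psi x = v); last first.
  by exists 0, 0 => x xv; case: empty; exists x.
have [_ _ /(_ (phi x0)) [A [C fE]]] := aff.
exists (\col_l if 0 < f x0 l 0 then A l 0 else 0).
exists (\col_l if 0 < f x0 l 0 then C l 0 else 0).
move=> x xv; have [pxx0 sgn] := psiP _ _ xv.
apply/matrixP => l i; rewrite (ord1 i) !mxE -sgn (fE x pxx0) !mxE.
have [h|h] := ltP 0 (x * A l 0 + C l 0) => //.
by rewrite mulr0 addr0.
Qed.

Lemma affine_pieces_hidden_layer (R : realType) (k : nat)
    (W : forall i, 'M[R]_(k, layer_dim k i)) (b : nat -> 'cV[R]_k) (i : nat) :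
  exists phi, affine_pieces (k.+1 ^ i) (hidden_layer W b i) phi.
Proof.
elim: i => [|i [phi /affine_pieces_affine aff]].
  exists (fun=> 0%N); split=> // v; exists (\col_(_ < 1) 1), 0 => x _.
  by apply/matrixP => l m; rewrite !mxE mulr1 addr0.
by rewrite expnSr; exact: affine_pieces_relu (aff _ _ _).
Qed.

(** The factor 2 is [p.+1] for the one-dimensional output layer, which is refined by sign although
    no [relu] is applied to it. *)
Lemma relu_network_sign_pieces (R : realType) (k t : nat) (h : R -> R) :
  relu_networks k t h ->
  exists psi : R -> nat,
    [/\ {homo psi : x y / x <= y >-> (x <= y)%N},
        forall x, (psi x < k.+1 ^ t.-1 * 2)%N
      & forall x y, psi x = psi y -> (0 < h x) = (0 < h y)].
Proof.
case=> W [b [Wo [bo hE]]].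
have [phi /affine_pieces_affine aff] := affine_pieces_hidden_layer W b t.-1.
have [psi [psi_homo psi_lt psiP]] := sign_refinement (aff _ Wo bo).
exists psi; split=> // x y /psiP [_ /(_ 0)].
by rewrite !hE.
Qed.

(** * Measurability of networks *)

Lemma measurable_hidden_layer (R : realType) (k : nat)
    (W : forall i, 'M[R]_(k, layer_dim k i)) (b : nat -> 'cV[R]_k) (i : nat) l :
  measurable_fun [set: R] (fun x => hidden_layer W b i x l 0).
Proof.
elim: i l => [|i IH] l /=.
  by under eq_fun do rewrite mxE; exact: measurable_id.
under eq_fun do rewrite !mxE.
apply: (@measurable_maxr _ _ _ _ _ (fun=> 0)); last exact: measurable_cst.
apply: measurable_funD; last exact: measurable_cst.
apply: measurable_sum => m; apply: measurable_funM => //; exact: measurable_cst.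
Qed.

Lemma measurable_relu_network (R : realType) (k t : nat) (h : R -> R) :
  relu_networks k t h -> measurable_fun [set: R] h.
Proof.
case=> W [b [Wo [bo hE]]].
rewrite (_ : h = fun x => \sum_i Wo 0 i * hidden_layer W b t.-1 x i 0 + bo 0 0).
  apply: measurable_funD; last exact: measurable_cst.
  apply: measurable_sum => m; apply: measurable_funM; first exact: measurable_cst.
  exact: measurable_hidden_layer.
by apply/funext => x; rewrite hE !mxE.
Qed.

(** * Geometry of the intervals of [Kset F j] *)

(** This is [Kinterval] on plain sequences, which makes induction on the word possible without
    tracking its length in the type. *)
Definition cylinder (R : realType) (r : nat) (F : affine_ifs R r)
  (s : seq 'I_r) : set R := (fun x => foldr (ifs_map F) x s) @` @K0 R.

Lemma cylinder_cons (R : realType) (r : nat) (F : affine_ifs R r) i s :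
  cylinder F (i :: s) = ifs_map F i @` cylinder F s.
Proof. by rewrite /cylinder -image_comp. Qed.

Lemma ifs_map_inj (R : realType) (r : nat) (F : affine_ifs R r) i :
  injective (ifs_map F i).
Proof. by move=> x y /addIr /(mulfI (slope_neq0 F i)). Qed.

(** An affine bijection preserves or reverses betweenness according to the sign of its slope, so the
    preimage [u] of an intermediate point is again intermediate. *)
Lemma is_interval_cylinder (R : realType) (r : nat) (F : affine_ifs R r) s :
  is_interval (cylinder F s).
Proof.
elim: s => [|i s IH].
  by rewrite /cylinder image_id; exact: interval_is_interval.
rewrite cylinder_cons => _ _ [a sa <-] [b sb <-] z /andP[az zb].
have m0 := slope_neq0 F i; set m := slope F i in m0.
have [u uz] : exists u, ifs_map F i u = z.
  exists ((z - Defs.shift F i) / m).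
  by rewrite /ifs_map mulrCA divff // mulr1 subrK.
rewrite -uz; apply: imageP; move: az zb; rewrite -uz /ifs_map -/m !lerD2r.
have [m_gt0|m_lt0|/eqP] := ltgtP 0 m; last by rewrite eq_sym (negPf m0).
  by rewrite !ler_pM2l // => au ub; apply: (IH a b) => //; rewrite au.
by rewrite !ler_nM2l // => ua bu; apply: (IH b a) => //; rewrite ua bu.
Qed.

Lemma cylinder_sub_K0 (R : realType) (r : nat) (F : affine_ifs R r) s :
  (forall i, ifs_map F i @` @K0 R `<=` @K0 R) -> cylinder F s `<=` @K0 R.
Proof.
move=> stab; elim: s => [|i s IH]; first by rewrite /cylinder image_id.
by rewrite cylinder_cons; apply: subset_trans (stab i); exact: image_subset.
Qed.

Lemma set_dist_gt0_disjoint (R : realType) (A B : set R) x :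
  0 < set_dist A B -> A x -> B x -> False.
Proof.
move=> d_gt0 Ax Bx; have : set_dist A B <= 0; last by rewrite leNgt d_gt0.
apply: ge_inf; first by exists 0 => _ [a _ [b _ <-]].
by exists x => //; exists x => //; rewrite subrr normr0.
Qed.

(** A common point forces equal first letters, because the first-level images are separated;
    injectivity of that first map then passes a common point to the tails. *)
Lemma cylinder_disjoint (R : realType) (r : nat) (F : affine_ifs R r) s s' x :
  (forall i, ifs_map F i @` @K0 R `<=` @K0 R) ->
  (forall i i', i != i' ->
     0 < set_dist (ifs_map F i @` @K0 R) (ifs_map F i' @` @K0 R)) ->
  size s = size s' -> cylinder F s x -> cylinder F s' x -> s = s'.
Proof.
move=> stab sep; elim: s s' x => [|i s IH] [|i' s'] // x [ss'].
rewrite !cylinder_cons => -[a sa ax] [b sb bx].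
have [eq_i|/sep dist] := eqVneq i i'; last first.
  by case: (set_dist_gt0_disjoint (x := x) dist); [exists a|exists b] => //;
    apply: (cylinder_sub_K0 stab); eassumption.
move: bx; rewrite -ax -eq_i => /ifs_map_inj ba.
by rewrite (IH _ a ss' sa) -?ba // eq_i.
Qed.

Lemma Kset_bigcup (R : realType) (r : nat) (F : affine_ifs R r) j :
  Kset F j = \bigcup_(w in [set: j.-tuple 'I_r]) Kinterval F w.
Proof.
elim: j => [|j IH] /=; apply/seteqP; split=> x.
- by move=> x0; exists [tuple] => //; exists x.
- by case=> w _; rewrite (tuple0 w) => -[y] ? <-.
- case=> i _ [y]; rewrite IH => -[w _ wy] <-; exists [tuple of i :: w] => //.
  by rewrite -[Kinterval F _]/(cylinder F (i :: w)) cylinder_cons; exists y.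
- case=> w _; case/tupleP: w => i w.
  rewrite -[Kinterval F _]/(cylinder F (i :: w)) cylinder_cons => -[y wy <-].
  by exists i => //; exists y => //; rewrite IH; exists w.
Qed.

Lemma Kset_nonincreasing (R : realType) (r : nat) (F : affine_ifs R r) j n :
  (forall i, ifs_map F i @` @K0 R `<=` @K0 R) ->
  (j <= n)%N -> Kset F n `<=` Kset F j.
Proof.
move=> stab; have step m : Kset F m.+1 `<=` Kset F m.
  elim: m => [|m IH] x [i _ Fx]; first exact: (stab i).
  by exists i => //; exact: image_subset IH _ Fx.
by move/subnK <-; elim: (n - j)%N => // m IH x /step; exact: IH.
Qed.

(** * Counting the intervals that meet several pieces *)

(* Two disjoint intervals on which psi is not constant cannot both contain a
   point where psi takes the same value followed by one where it is larger. *)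
Lemma card_nonconstant_intervals (R : realType) (T : finType) (I : T -> set R)
    (psi : R -> nat) (M : nat) (P : {pred T}) :
  (forall t, is_interval (I t)) ->
  (forall t t' x, I t x -> I t' x -> t = t') ->
  {homo psi : x y / x <= y >-> (x <= y)%N} ->
  (forall x, (psi x < M)%N) ->
  (forall t, t \in P -> exists x y, [/\ I t x, I t y & psi x <> psi y]) ->
  (#|P| <= M)%N.
Proof.
move=> itvI disjI psi_homo psi_lt nonconst.
(* The chosen [x t] is a point of [I t] with a larger value of [psi] further right in [I t]; 0 is a
   dummy value outside [P]. *)
have /choice[x xP] t : exists x : R, t \in P ->
    exists2 y, I t x /\ I t y & (psi x < psi y)%N.
  have [/nonconst[x [y [tx ty /eqP]]]|] := boolP (t \in P); last by exists 0.
  by rewrite neq_ltn => /orP[xy|yx]; [exists x => _; exists y|exists y => _; exists x].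
suff xinj : {in P &, injective (fun t => Ordinal (psi_lt (x t)))}.
  by rewrite -[M]card_ord; exact: leq_card_in xinj.
move=> t t' Pt Pt' [eq_psi].
wlog xx' : t t' Pt Pt' eq_psi / x t <= x t'.
  by move=> th; case: (leP (x t) (x t')) => [|/ltW] xx'; [|symmetry]; exact: th.
have [y [tx ty] psi_xy] := xP t Pt; have [_ [tx' _] _] := xP t' Pt'.
(* If [y <= x t'], monotonicity contradicts the equal values at [x t] and [x t']; otherwise [x t']
   lies between two points of [I t]. *)
have [yx'|x'y] := leP y (x t').
  by move: psi_xy; rewrite eq_psi ltnNge psi_homo.
by apply: (disjI t t' (x t')) => //; apply: (itvI t (x t) y); rewrite ?xx' ?ltW.
Qed.

(** * Finite unions and measurability of the error set *)

Lemma measure_bigcup_finType d (T : measurableType d) (R : realType)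
    (mu : {measure set T -> \bar R}) (I : finType) (P : {pred I})
    (A : I -> set T) :
  (forall i, measurable (A i)) -> trivIset [set: I] A ->
  mu (\bigcup_(i in [set` P]) A i) = (\sum_(i in P) mu (A i))%E.
Proof.
move=> mA tA; rewrite measure_fin_bigcup //; last exact: sub_trivIset tA.
by rewrite (@bigfs _ _ _ _ (index_enum I)) ?index_enum_uniq // => i _; rewrite mem_index_enum.
Qed.

Lemma measurable_error_set (R : realType) (h : R -> R) :
  measurable_fun [set: R] h ->
  measurable [set xy : R * bool | Num.sg (h xy.1) != label R xy.2].
Proof.
move=> mh.
have mtrue : measurable [set true] by [].
have mpos : measurable [set x | 0 < h x].
  rewrite -[X in measurable X]setTI.
  exact: (measurable_fun_ltr (measurable_cst (0 : R)) mh measurableT mtrue).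
have mneg : measurable [set x | h x < 0].
  rewrite -[X in measurable X]setTI.
  exact: (measurable_fun_ltr mh (measurable_cst (0 : R)) measurableT mtrue).
(* Zeros of [h] count as errors for both labels, hence complements of the strict sign sets. *)
rewrite (_ : [set _ | _] = (~` [set x | 0 < h x] `*` [set true])
  `|` (~` [set x | h x < 0] `*` [set false])).
  by apply: measurableU; apply: measurableX => //; exact: measurableC.
apply/seteqP; split=> -[x []] /=.
- move=> /eqP hx; left; split=> // h0; apply: hx; exact: gtr0_sg.
- move=> /eqP hx; right; split=> // h0; apply: hx; exact: ltr0_sg.
- case=> -[]// h0 _; apply: contra_notN h0; rewrite -sgr_cp0.
  by rewrite /label.
- case=> -[]// h0 _; apply: contra_notN h0; rewrite -sgr_cp0.
  by rewrite /label.
Qed.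

Lemma measurable_Kinterval (R : realType) (r : nat) (F : affine_ifs R r) j
  (w : j.-tuple 'I_r) : measurable (Kinterval F w).
Proof. by apply: is_interval_measurable; exact: is_interval_cylinder. Qed.

(** * Lower bound on the error of a single classifier *)

Section ErrorLowerBound.
Variables (R : realType) (r n : nat) (F : affine_ifs R r).
Variables (D Dp Dm : probability (R * bool)%type R).
Hypothesis stab : forall i, ifs_map F i @` @K0 R `<=` @K0 R.
Hypothesis sep : forall i i', i != i' ->
  0 < set_dist (ifs_map F i @` @K0 R) (ifs_map F i' @` @K0 R).
Hypothesis frac : fractal_distribution F n D Dp Dm.

Let mX j (w : j.-tuple 'I_r) (y : bool) :
  measurable (Kinterval F w `*` [set y]).
Proof. by apply: measurableX => //; exact: measurable_Kinterval. Qed.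

Lemma Kinterval_disjoint j (w w' : j.-tuple 'I_r) x :
  Kinterval F w x -> Kinterval F w' x -> w = w'.
Proof.
move=> wx w'x; apply/val_inj.
by apply: (cylinder_disjoint stab sep _ wx w'x); rewrite !size_tuple.
Qed.

(** The label may vary with the word, because the label misclassified on an interval depends on that
    interval. *)
Lemma trivIset_Kinterval j (y : j.-tuple 'I_r -> bool) :
  trivIset [set: j.-tuple 'I_r] (fun w => Kinterval F w `*` [set y w]).
Proof.
apply/trivIsetP => w w' _ _ /eqP ww'; apply/seteqP; split=> // -[x b].
by case=> -[/= wx _] [/= w'x _]; apply: ww'; exact: Kinterval_disjoint wx w'x.
Qed.

Lemma Kset_setX j (y : bool) :
  Kset F j `*` [set y] =
  \bigcup_(w in [set` {: j.-tuple 'I_r}]) (Kinterval F w `*` [set y]).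
Proof.
rewrite Kset_bigcup; apply/seteqP; split=> -[x b] /=.
- by case=> -[w _ wx] by_; exists w.
- by case=> w _ [/= wx by_]; split=> //; exists w.
Qed.

Lemma measurable_Kset_setX j (y : bool) : measurable (Kset F j `*` [set y]).
Proof.
by rewrite Kset_setX; apply: fin_bigcup_measurable.
Qed.

Lemma measure_Kset_setX j (y : bool) :
  D (Kset F j `*` [set y]) =
  (\sum_(w in {: j.-tuple 'I_r}) D (Kinterval F w `*` [set y]))%E.
Proof.
by rewrite Kset_setX measure_bigcup_finType //; exact: trivIset_Kinterval.
Qed.

(** As [Kset F n] lies in [Kset F j], all of [Dp] sits on the positive side, while [Dm] puts mass at
    most 1 on the negative side; both carry the weight 1/2. *)
Lemma measure_Kset_label_le j : (j <= n)%N ->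
  (D (Kset F j `*` [set false]) <= D (Kset F j `*` [set true]))%E.
Proof.
move=> jn; have [DE Dp_supp _] := frac.
have mK := measurable_Kset_setX j.
have Dp1 : Dp (Kset F j `*` [set true]) = 1%E.
  apply/eqP; rewrite eq_le probability_le1 //= -Dp_supp.
  apply: le_measure; rewrite ?inE //; first exact: measurable_Kset_setX.
  by move=> [x b] [/= Kx bT]; split=> //; exact: Kset_nonincreasing Kx.
have Dp0 : Dp (Kset F j `*` [set false]) = 0%E.
  apply/eqP; rewrite eq_le measure_ge0 andbT.
  apply: (@le_trans _ _ (Dp (~` (Kset F j `*` [set true])))).
    apply: le_measure; rewrite ?inE //; first exact: measurableC.
    by move=> [x b] [/= _ ->] [].
  by rewrite probability_setC // Dp1 subee.
rewrite !DE // lee_pmul2l // Dp1 Dp0 add0e.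
by rewrite (le_trans (probability_le1 Dm (mK false))) // leeDl.
Qed.

Lemma one_sub_approx_curve j :
  (1 - approx_curve F D j)%E = D (Kset F j `*` [set false]).
Proof.
rewrite /approx_curve (_ : [set _ | _] = ~` (Kset F j `*` [set false])).
  have mK := measurable_Kset_setX j false.
  rewrite probability_setC // -(fineK (fin_num_measure D _ mK)).
  by rewrite -!EFinB opprB addrC subrK.
apply/seteqP; split=> -[x []] /=.
- by move=> _ [].
- by case=> // nK [].
- by right.
- by move=> nK; left=> Kx; apply: nK.
Qed.

Hypothesis same_mass : forall (j : nat) (w w' : j.-tuple 'I_r) (y : bool),
  D (Kinterval F w `*` [set y]) = D (Kinterval F w' `*` [set y]).
Hypothesis r_gt0 : (0 < r)%N.

Lemma error_ge_nonconstant j (h : R -> R) (psi : R -> nat) (M : nat) :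
  (j <= n)%N -> measurable_fun [set: R] h ->
  {homo psi : x y / x <= y >-> (x <= y)%N} ->
  (forall x, (psi x < M)%N) ->
  (forall x y, psi x = psi y -> (0 < h x) = (0 < h y)) ->
  ((1 - M%:R / r%:R ^+ j)%:E * (1 - approx_curve F D j) <= error D h)%E.
Proof.
move=> jn mh psi_homo psi_lt psiP.
pose w0 : j.-tuple 'I_r := nseq_tuple j (Ordinal r_gt0).
pose c y := fine (D (Kinterval F w0 `*` [set y])).
have cE (w : j.-tuple 'I_r) y : D (Kinterval F w `*` [set y]) = (c y)%:E.
  by rewrite (same_mass w w0) fineK // fin_num_measure.
have DK y : D (Kset F j `*` [set y]) = (r%:R ^+ j * c y)%:E.
  rewrite measure_Kset_setX; under eq_bigr do rewrite cE.
  by rewrite sumEFin sumr_const card_tuple card_ord -natrX mulr_natl.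
have rj_gt0 : 0 < r%:R ^+ j :> R by rewrite exprn_gt0 // ltr0n.
have c_ge0 : 0 <= c false by rewrite fine_ge0.
have c_le y : c false <= c y.
  case: y => //; have := measure_Kset_label_le jn.
  by rewrite !DK lee_fin ler_pM2l.
rewrite one_sub_approx_curve DK -EFinM mulrA mulrBl mul1r divfK ?gt_eqF //.
(* On a good interval [psi], hence the positivity of [h], is constant. *)
pose good := [pred w : j.-tuple 'I_r |
  `[< forall x y, Kinterval F w x -> Kinterval F w y -> psi x = psi y >]].
pose pt (w : j.-tuple 'I_r) : R := foldr (ifs_map F) 0 w.
have ptP (w : j.-tuple 'I_r) : Kinterval F w (pt w).
  by exists 0 => //; rewrite /K0 /= in_itv /= lerN10 ler01.
(* This is the label that [h] gets wrong on all of a good interval, read off at the sample point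
   [pt w]. *)
pose y w := ~~ (0 < h (pt w)).
have sub : \bigcup_(w in [set` good]) (Kinterval F w `*` [set y w]) `<=`
    [set xy | Num.sg (h xy.1) != label R xy.2].
  move=> [x b] [w /asboolP good_w [/= wx ->]]; rewrite /y.
  rewrite -(psiP x (pt w)); last exact: good_w.
  have [h0|h0] := ltP 0 (h x); rewrite /label /=.
    by rewrite gtr0_sg // gt_eqF // (lt_trans (ltrN10 R)).
  by rewrite sgr_cp0 -leNgt.
apply: (@le_trans _ _ (\sum_(w in good) D (Kinterval F w `*` [set y w]))%E);
  last first.
  rewrite -measure_bigcup_finType //; last exact: trivIset_Kinterval.
  apply: le_measure => //; rewrite inE; last exact: measurable_error_set.
  by apply: fin_bigcup_measurable.
under eq_bigr do rewrite cE.
rewrite sumEFin lee_fin.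
apply: (@le_trans _ _ (\sum_(w in good) c false)); last exact: ler_sum.
rewrite sumr_const -(mulr_natl (c false)) ler_wpM2r //.
rewrite lerBlDr -natrX -natrD ler_nat.
have <- : #|{: j.-tuple 'I_r}| = (r ^ j)%N by rewrite card_tuple card_ord.
(* It remains to see that at most [M] words are not good. *)
rewrite -(cardC good) leq_add2l.
apply: (@card_nonconstant_intervals _ _ (@Kinterval _ _ F j) psi) => //.
- by move=> w; exact: is_interval_cylinder.
- exact: Kinterval_disjoint.
- move=> w; rewrite !inE => /asboolPn; apply: contra_notP => const x z wx wz.
  by apply: contra_notP const => ne; exists x, z.
Qed.

End ErrorLowerBound.

Theorem theorem4 (R : realType) (r n : nat) (F : affine_ifs R r)
  (D Dp Dm : probability (R * bool)%type R) :
  (1 <= r)%N -> (1 <= n)%N ->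
  (exists eps : R, 0 < eps /\ forall i i' : 'I_r, i != i' ->
     eps < set_dist (ifs_map F i @` @K0 R) (ifs_map F i' @` @K0 R)) ->
  (forall i : 'I_r, ifs_map F i @` @K0 R `<=` @K0 R) ->
  fractal_distribution F n D Dp Dm ->
  (exists gamma : R, 0 < gamma /\
     supported_on Dp (shrink (Kset F n) gamma `*` [set true])) ->
  (forall (j : nat) (w w' : j.-tuple 'I_r) (y : bool),
     D (Kinterval F w `*` [set y]) = D (Kinterval F w' `*` [set y])) ->
  forall t s k j : nat,
    (1 <= t)%N -> (1 <= s)%N -> (k < r ^ s)%N -> (s * t < j < n)%N ->
    ((1 - r%:R ^ ((s * t)%:Z - j%:Z))%:E * (1 - approx_curve F D j)
       <= class_error D (relu_networks k t))%E.
Proof.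
move=> r_gt0 _ [eps [eps_gt0 eps_sep]] stab frac _ same_mass t s k j.
move=> t_gt0 s_gt0 k_lt /andP[stj /ltnW jn].
have sep i i' : i != i' ->
    0 < set_dist (ifs_map F i @` @K0 R) (ifs_map F i' @` @K0 R).
  by move/eps_sep; exact: lt_trans.
apply: le_ereal_inf_tmp => _ [h net_h <-].
have mh := measurable_relu_network net_h.
have r_neq0 : r%:R != 0 :> R by rewrite pnatr_eq0 -lt0n.
have -> : r%:R ^ ((s * t)%:Z - j%:Z) = (r ^ (s * t))%:R / r%:R ^+ j :> R.
  by rewrite expfzDr // natrX -exprnP exprnN.
(* For [r = 1] the factor 2 cannot be absorbed into [r ^ s], but the claimed bound is 0. *)
have [r1|r_neq1] := eqVneq r 1%N.
  have -> : (r ^ (s * t))%:R / r%:R ^+ j = 1 :> R.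
    by rewrite r1 exp1n expr1n divr1.
  by rewrite subrr mul0e measure_ge0.
have [psi [psi_homo psi_lt psiP]] := relu_network_sign_pieces net_h.
apply: (error_ge_nonconstant stab sep frac same_mass r_gt0 jn mh psi_homo) => // x.
apply: leq_trans (psi_lt x) _.
(* Splitting [r ^ (s * t)] as [(r ^ s) ^ t.-1 * r ^ s], the first factor dominates [k.+1 ^ t.-1] and
   the second, being at least [r], dominates 2. *)
rewrite -{2}(prednK t_gt0) (mulnS s) addnC expnD expnM leq_mul //.
  by case: t.-1 => // t'; rewrite leq_exp2r.
rewrite (@leq_trans r) //; first by rewrite ltn_neqAle eq_sym r_neq1.
by rewrite -{1}(expn1 r) leq_pexp2l.
Qed.
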